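(* Let $(X,c)$ be a session coalgebra and consider the session type system for $\pi$-calculus processes with channel types in $X$. For every context $\Gamma$, variable $x\notin\mathrm{dom}(\Gamma)$, process $P$ and states $T,U\in X$: if $\Gamma, x:T\vdash P$ and $U\sqsubseteq T$, then $\Gamma, x:U\vdash P$. (That is, the subsumption rule is admissible.)
   Context: Session coalgebra: fix basic data types $D$ with a decidable preorder $\le_D$ and labels $\mathbb{L}$. A session coalgebra is a set $X$ with $c(x)=(\sigma(x),\delta(x))$, $\sigma(x)$ one of $(\mathrm{com},p)$ ($p\in\{\mathrm{in},\mathrm{out}\}$), $(\mathrm{branch},p,L)$ ($L\subseteq\mathbb{L}$ finite nonempty), $\mathrm{end}$, $(\mathrm{bsc},d)$ ($d\in D$), $\mathrm{par}$; and $\delta(x)\colon B_{\sigma(x)}\to X$ with $B_{(\mathrm{com},p)}=\{*,1\}$, $B_{(\mathrm{branch},p,L)}=L$, $B_{\mathrm{end}}=B_{(\mathrm{bsc},d)}=\emptyset$, $B_{\mathrm{par}}=\{*\}$. Abbreviations: $?=(\mathrm{com},\mathrm{in})$, $!=(\mathrm{com},\mathrm{out})$, $\&=(\mathrm{branch},\mathrm{in})$, $\oplus=(\mathrm{branch},\mathrm{out})$. Bisimilarity $\sim$: greatest $R\subseteq X\times X$ such that for $(x,y)\in R$ either $\sigma(x)=\sigma(y)$ and $\delta(x)(\alpha)\,R\,\delta(y)(\alpha)$ for all $\alpha$, or $\sigma(x)=(\mathrm{bsc},d),\sigma(y)=(\mathrm{bsc},d')$ with $d\le_D d'$ and $d'\le_D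 d$. Parallelizability: $Y\subseteq X$ is parallelizable if closed under all transitions and for all $u,w\in Y$: $u\sim w$ or $\sigma(u)=\mathrm{par}$ or $\sigma(w)=\mathrm{par}$. A state $x$ is parallelizable, $\mathrm{par}(x)$, if the least set containing $x$ and closed under continuation transitions (the transition $*$ of com states, all transitions of other states) is parallelizable. Similarity $\sqsubseteq$: greatest $R$ such that each $(x,y)\in R$ satisfies one of: $\sigma(x)=\sigma(y)=(\mathrm{com},\mathrm{in})$, $\delta(x)( * )R\delta(y)( * )$, $\delta(x)(1)R\delta(y)(1)$; $\sigma(x)=\sigma(y)=(\mathrm{com},\mathrm{out})$, $\delta(x)( * )R\delta(y)( * )$, $\delta(y)(1)R\delta(x)(1)$; $\sigma(x)=(\mathrm{branch},\mathrm{in},L_1)$, $\sigma(y)=(\mathrm{branch},\mathrm{in},L_2)$, $L_1\subseteq L_2$, $\delta(x)(l)R\delta(y)(l)$ for $l\in L_1$; $\sigma(x)=(\mathrm{branch},\mathrm{out},L_1)$, $\sigma(y)=(\mathrm{branch},\mathrm{out},L_2)$, $L_2\subseteq L_1$, $\delta(x)(l)R\delta(y)(l)$ for $l\in L_2$; $\sigma(x)=(\mathrm{bsc},d),\sigma(y)=(\mathrm{bsc},d')$, $d\le_D d'$; $\sigma(x)=\sigma(y)=\mathrm{end}$; $\sigma(x)=\sigma(y)=\mathrm{par}$, $\delta(x)( * )R\delta(y)( * )$ and $\mathrm{par}(\delta(x)( * ))$ iff $\mathrm{par}(\delta(y)( * ))$. Duality $\bot$: greatest $R$ such that for $(x,y)\in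 R$: $\sigma(y)=\overline{\sigma(x)}$ where $\overline{(\mathrm{com},p)}=(\mathrm{com},\overline p)$, $\overline{(\mathrm{branch},p,L)}=(\mathrm{branch},\overline p,L)$, $\overline{\mathrm{end}}=\mathrm{end}$, $\overline{\mathrm{par}}=\mathrm{par}$, $\overline{\mathrm{in}}=\mathrm{out}$, $\overline{\mathrm{out}}=\mathrm{in}$ (no bsc state has a dual); $\delta(x)(\alpha)R\delta(y)(\alpha)$ for continuation labels $\alpha$; $\delta(x)(1)\sim\delta(y)(1)$ for com states. Processes: $P,Q::=\overline{x}\langle y\rangle.P\mid x(y).P\mid x\rhd\{l_i:P_i\}_{i\in I}\mid x\lhd l.P\mid P\mid Q\mid\ !P\mid\mathbf{0}\mid(\nu xy)P$. A context $\Gamma$ is a finite set of pairs $x:T$ ($T\in X$) with at most one pair per variable; $\Gamma,x:T$ presupposes $x\notin\mathrm{dom}(\Gamma)$. $T$ is unrestricted, $\mathrm{un}(T)$, if $\sigma(T)\in\{\mathrm{par},\mathrm{end}\}$ or $\sigma(T)=(\mathrm{bsc},d)$; $\mathrm{un}(\Gamma)$ if all its types are unrestricted. Context split $\Gamma=\Gamma_1\circ\Gamma_2$ is the least relation with $\emptyset=\emptyset\circ\emptyset$ and, if $\Gamma=\Gamma_1\circ\Gamma_2$: $\Gamma,x:T=(\Gamma_1,x:T)\circ(\Gamma_2,x:T)$ when $\mathrm{un}(T)$; $\Gamma,x:T=(\Gamma_1,x:T)\circ\Gamma_2$; $\Gamma,x:T=\Gamma_1\circ(\Gamma_2,x:T)$.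 Typing rules ($\Gamma\vdash P$ is derivable by): (Inact) $\mathrm{un}(\Gamma)\Rightarrow\Gamma\vdash\mathbf{0}$; (Res) $\Gamma,x:T,y:U\vdash P$ and $T\bot U\Rightarrow\Gamma\vdash(\nu xy)P$; (Par) $\Gamma_1\vdash P$, $\Gamma_2\vdash Q\Rightarrow\Gamma_1\circ\Gamma_2\vdash P\mid Q$; (Rep) $\Gamma\vdash P$, $\mathrm{un}(\Gamma)\Rightarrow\Gamma\vdash\,!P$; (In) $\sigma(T)=?$, $f=\delta(T)$, $\Gamma,y:U,x:f( * )\vdash P$, $f(1)\sqsubseteq U\Rightarrow\Gamma,x:T\vdash x(y).P$; (Out) $\sigma(T)=!$, $f=\delta(T)$, $\Gamma,x:f( * )\vdash P$, $U\sqsubseteq f(1)\Rightarrow\Gamma,x:T,y:U\vdash\overline{x}\langle y\rangle.P$; (Branch) $\sigma(T)=(\mathrm{branch},\mathrm{in},L_1)$, $f=\delta(T)$, $L_1\subseteq L_2$, $\Gamma,x:f(l)\vdash P_l$ for all $l\in L_1$ $\Rightarrow\Gamma,x:T\vdash x\rhd\{l:P_l\}_{l\in L_2}$; (Sel) $\sigma(T)=(\mathrm{branch},\mathrm{out},L)$, $f=\delta(T)$, $l\in L$, $\Gamma,x:f(l)\vdash P_l\Rightarrow\Gamma,x:T\vdash x\lhd l.P_l$; (Unpack) $\sigma(T)=\mathrm{par}$, $\mathrm{par}(T)$, $\Gamma,x:\delta(T)( * )\vdash P\Rightarrow\Gamma,x:T\vdash P$.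
   Formalization: A parallelizable set is required to be closed only under continuation transitions, not under all transitions (the data transition 1 of com states is not followed); with closure under all transitions, subsumption fails. *)

(* Defs.v *)
From mathcomp Require Import all_boot.
From mathcomp Require Export finmap.

Set Implicit Arguments.
Unset Strict Implicit.
Unset Printing Implicit Defensive.

Local Open Scope fset_scope.
Local Open Scope fmap_scope.

Inductive polarity := pin | pout.

Definition pdual (p : polarity) : polarity :=
  match p with pin => pout | pout => pin end.

Section Coalgebras.

Variables (D : Type) (leD : rel D) (Lab : choiceType).

Definition nefset := {L : {fset Lab} | L != fset0}.

Inductive shape :=
| com of polarity
| branch of polarity & nefset
| end_
| bsc of D
| par.

(* The two transitions of a communication state: [c_star] is written * (the
   continuation), [c_one] is written 1 (the data that is exchanged). *)
Inductive com_label := c_star | c_one.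

Definition B (s : shape) : Type :=
  match s with
  | com _ => com_label
  | branch _ L => val L
  | end_ => void
  | bsc _ => void
  | par => unit
  end.

(* A session coalgebra with state set X is a map X -> session_functor X. *)
Definition session_functor (X : Type) := {s : shape & B s -> X}.

Definition node X (s : shape) (f : B s -> X) : session_functor X :=
  existT _ s f.

Section Relations.

Variables (X : Type) (c : X -> session_functor X).

Definition sigma (x : X) : shape := projT1 (c x).

Definition delta (x : X) : B (sigma x) -> X := projT2 (c x).

(* The union of all R contained in F R; for monotone F (as are all the
   functionals below) it is itself contained in its image by F, hence it is the
   greatest such relation. *)
Definition greatest (F : (X -> X -> Prop) -> X -> X -> Prop) (x y : X) : Prop :=
  exists2 R : X -> X -> Prop, (forall u w, R u w -> F R u w) & R x y.

Inductive bisim_step (R : X -> X -> Prop) (x y : X) : Prop :=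
| bisim_same s (f g : B s -> X) of
    c x = node f & c y = node g & forall a, R (f a) (g a)
| bisim_bsc d d' of
    sigma x = bsc d & sigma y = bsc d' & leD d d' & leD d' d.

Definition bisim := greatest bisim_step.

Definition is_cont (s : shape) : B s -> Prop :=
  match s with
  | com _ => fun a => a = c_star
  | _ => fun _ => True
  end.

Definition cont_trans (x y : X) : Prop :=
  exists2 a : B (sigma x), is_cont a & y = delta a.

Inductive cont_closure (x : X) : X -> Prop :=
| cont_self : cont_closure x x
| cont_next u w of cont_closure x u & cont_trans u w : cont_closure x w.

(* The transitions under which Y is closed are those that generate
   [cont_closure], i.e. the continuation transitions; the data transition 1 of a
   com state is not followed. Requiring the closure also under data transitions
   would rule out x with sigma x = par, x -*-> y, sigma y = com in, y -*-> x,
   y -1-> int, and subsumption would fail: for T -*-> y, y -*-> y, y -1-> T and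
   U -*-> w, w -*-> w, w -1-> T (T, U par; y, w com in), U is below T and T would
   be parallelizable, but U would not. *)
Definition parallelizable (Y : X -> Prop) : Prop :=
  (forall u w, Y u -> cont_trans u w -> Y w) /\
  (forall u w, Y u -> Y w -> [\/ bisim u w, sigma u = par | sigma w = par]).

Definition parst (x : X) : Prop := parallelizable (cont_closure x).

Inductive sim_step (R : X -> X -> Prop) (x y : X) : Prop :=
| sim_in (f g : B (com pin) -> X) of
    c x = node f & c y = node g &
    R (f c_star) (g c_star) & R (f c_one) (g c_one)
| sim_out (f g : B (com pout) -> X) of
    c x = node f & c y = node g &
    R (f c_star) (g c_star) & R (g c_one) (f c_one)
| sim_branch L1 L2 (f : B (branch pin L1) -> X) (g : B (branch pin L2) -> X) of
    c x = node f & c y = node g & val L1 `<=` val L2 &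
    forall l (h1 : l \in val L1) (h2 : l \in val L2), R (f [` h1]) (g [` h2])
| sim_select L1 L2 (f : B (branch pout L1) -> X) (g : B (branch pout L2) -> X) of
    c x = node f & c y = node g & val L2 `<=` val L1 &
    forall l (h1 : l \in val L1) (h2 : l \in val L2), R (f [` h1]) (g [` h2])
| sim_bsc d d' of
    sigma x = bsc d & sigma y = bsc d' & leD d d'
| sim_end of
    sigma x = end_ & sigma y = end_
| sim_par (f g : B par -> X) of
    c x = node f & c y = node g &
    R (f tt) (g tt) & (parst (f tt) <-> parst (g tt)).

Definition sim := greatest sim_step.

Inductive dual_step (R : X -> X -> Prop) (x y : X) : Prop :=
| dual_com p (f : B (com p) -> X) (g : B (com (pdual p)) -> X) of
    c x = node f & c y = node g &
    R (f c_star) (g c_star) & bisim (f c_one) (g c_one)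
| dual_branch p L (f : B (branch p L) -> X) (g : B (branch (pdual p) L) -> X) of
    c x = node f & c y = node g & forall l : val L, R (f l) (g l)
| dual_end of
    sigma x = end_ & sigma y = end_
| dual_par (f g : B par -> X) of
    c x = node f & c y = node g & R (f tt) (g tt).

Definition duality := greatest dual_step.

Definition un (T : X) : Prop :=
  [\/ sigma T = par, sigma T = end_ | exists d, sigma T = bsc d].

End Relations.

Section Typing.

Variable V : choiceType.

(* Raw terms: no identification up to renaming of bound variables. *)
Inductive proc :=
| POut of V & V & proc                            (* x<y>.P *)
| PIn of V & V & proc                             (* x(y).P *)
| PBranch (x : V) (L : {fset Lab}) of L -> proc   (* x |> {l : P l}_(l in L) *)
| PSel of V & Lab & proc                          (* x <| l.P *)
| PPar of proc & proc
| PRep of proc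
| PNil
| PRes of V & V & proc.

Variables (X : Type) (c : X -> session_functor X).

Definition un_ctx (G : {fmap V -> X}) : Prop :=
  forall x T, G.[? x] = Some T -> un c T.

(* The context "G, x : T" is G.[x <- T] where x \notin domf G. *)
Inductive ctx_split : {fmap V -> X} -> {fmap V -> X} -> {fmap V -> X} -> Prop :=
| split_nil : ctx_split [fmap] [fmap] [fmap]
| split_both G G1 G2 x T of
    ctx_split G G1 G2 & x \notin domf G & un c T :
    ctx_split G.[x <- T] G1.[x <- T] G2.[x <- T]
| split_left G G1 G2 x T of
    ctx_split G G1 G2 & x \notin domf G :
    ctx_split G.[x <- T] G1.[x <- T] G2
| split_right G G1 G2 x T of
    ctx_split G G1 G2 & x \notin domf G :
    ctx_split G.[x <- T] G1 G2.[x <- T].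

Inductive typed : {fmap V -> X} -> proc -> Prop :=
| ty_inact G of
    un_ctx G :
    typed G PNil
| ty_res G x y T U P of
    x \notin domf G & y \notin domf G.[x <- T] &
    typed G.[x <- T].[y <- U] P & duality c T U :
    typed G (PRes x y P)
| ty_par G G1 G2 P Q of
    ctx_split G G1 G2 & typed G1 P & typed G2 Q :
    typed G (PPar P Q)
| ty_rep G P of
    typed G P & un_ctx G :
    typed G (PRep P)
| ty_in G x y T U P (f : B (com pin) -> X) of
    c T = node f &
    y \notin domf G & x \notin domf G.[y <- U] &
    typed G.[y <- U].[x <- f c_star] P & sim c (f c_one) U :
    typed G.[x <- T] (PIn x y P)
| ty_out G x y T U P (f : B (com pout) -> X) of
    c T = node f &
    x \notin domf G & y \notin domf G.[x <- T] &
    typed G.[x <- f c_star] P & sim c U (f c_one) :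
    typed G.[x <- T].[y <- U] (POut x y P)
| ty_branch G x T L1 (L2 : {fset Lab}) (P : L2 -> proc)
    (f : B (branch pin L1) -> X) of
    c T = node f & x \notin domf G & val L1 `<=` L2 &
    (forall l (h1 : l \in val L1) (h2 : l \in L2),
       typed G.[x <- f [` h1]] (P [` h2])) :
    typed G.[x <- T] (PBranch x P)
| ty_sel G x T L l P (f : B (branch pout L) -> X) (h : l \in val L) of
    c T = node f & x \notin domf G &
    typed G.[x <- f [` h]] P :
    typed G.[x <- T] (PSel x l P)
| ty_unpack G x T P (f : B par -> X) of
    c T = node f & parst c T & x \notin domf G &
    typed G.[x <- f tt] P :
    typed G.[x <- T] P.

End Typing.

End Coalgebras.

(* Main.v *)
(* Subsumption is proved for all variables of the context at once, by induction
   on the typing derivation: replacing every type by a smaller one keeps the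
   domain and unrestrictedness, hence context splits, and transitivity of
   similarity absorbs the change in the data premises of input and output.
   Unpacking goes through because a state of shape par is parallelizable exactly
   when its successor is, and similarity preserves the latter by definition. *)
Require Import Defs.
From mathcomp Require Import all_boot finmap.

Set Implicit Arguments.
Unset Strict Implicit.
Unset Printing Implicit Defensive.

Local Open Scope fset_scope.
Local Open Scope fmap_scope.

(** * Similarity of states: unfolding, coinduction, preorder laws *)

Section Similarity.

Variables (D : Type) (leD : rel D) (Lab : choiceType).
Variables (X : Type) (c : X -> session_functor D Lab X).

Lemma cont_trans_par (x y : X) (f : B (par D Lab) -> X) :
  c x = node f -> cont_trans c x y <-> y = f tt.
Proof.
rewrite /cont_trans /delta /sigma; move: (c x) => w ->.
by split=> [[[] _ ->] | ->]; last by exists tt.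
Qed.

(** The closure of [x] is that of its only successor [f tt] together with [x] itself. Pairs
    involving [x] meet the condition at once, since [x] has shape [par]; all other pairs lie in the
    closure of [f tt]. *)
Lemma parst_par (x : X) (f : B (par D Lab) -> X) :
  c x = node f -> parst leD c x <-> parst leD c (f tt).
Proof.
move=> cx.
have closureE w : cont_closure c x w <-> w = x \/ cont_closure c (f tt) w.
  split.
    elim=> {w} [|u w _ [->|uP] uw]; first by left.
      by right; move/(cont_trans_par _ cx): uw => ->; exact: cont_self.
    by right; exact: cont_next uw.
  case=> [->|]; first exact: cont_self.
  elim=> {w} [|u w _]; last exact: cont_next.
  by apply: (cont_next (cont_self _ _)); apply/(cont_trans_par _ cx).
have sx : sigma c x = par D Lab by rewrite /sigma cx.
split=> -[_ pairP]; split; try by move=> u w; exact: cont_next.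
  by move=> u w uP wP; apply: pairP; apply/closureE; right.
move=> u w /closureE[->|uP] /closureE[->|wP]; try by constructor 2.
  by constructor 3.
exact: pairP.
Qed.

(* [sim_step R x y] by recursion on the shape of the node [w = c y]: rewriting
   with [c y = node g] then needs no injectivity of [existT]. *)
Definition sim_view (R : X -> X -> Prop) (x : X)
    (w : session_functor D Lab X) : Prop :=
  let: existT s g := w in
  match s return (B s -> X) -> Prop with
  | com pin => fun g => exists f : B (com D Lab pin) -> X,
      [/\ c x = node f, R (f c_star) (g c_star) & R (f c_one) (g c_one)]
  | com pout => fun g => exists f : B (com D Lab pout) -> X,
      [/\ c x = node f, R (f c_star) (g c_star) & R (g c_one) (f c_one)]
  | branch pin L2 => fun g => exists L1 (f : B (branch D pin L1) -> X),
      [/\ c x = node f, val L1 `<=` val L2 &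
        forall l (h1 : l \in val L1) (h2 : l \in val L2),
          R (f [` h1]) (g [` h2])]
  | branch pout L2 => fun g => exists L1 (f : B (branch D pout L1) -> X),
      [/\ c x = node f, val L2 `<=` val L1 &
        forall l (h1 : l \in val L1) (h2 : l \in val L2),
          R (f [` h1]) (g [` h2])]
  | end_ => fun _ => exists f : B (end_ D Lab) -> X, c x = node f
  | bsc d' => fun _ => exists d (f : B (bsc Lab d) -> X),
      c x = node f /\ leD d d'
  | par => fun g => exists f : B (par D Lab) -> X,
      [/\ c x = node f, R (f tt) (g tt) &
        parst leD c (f tt) <-> parst leD c (g tt)]
  end g.

Lemma node_sigma (x : X) (s : Defs.shape D Lab) :
  sigma c x = s -> exists f : B s -> X, c x = node f.
Proof. by rewrite /sigma; case: (c x) => s' f /= <-; exists f. Qed.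

Lemma sim_stepP (R : X -> X -> Prop) (x y : X) :
  sim_step leD c R x y <-> sim_view R x (c y).
Proof.
split.
  case=> [f g|f g|L1 L2 f g|L1 L2 f g|d d'|/node_sigma[f cx]|f g].
  - by move=> cx -> ? ?; exists f.
  - by move=> cx -> ? ?; exists f.
  - by move=> cx -> ? ?; exists L1, f.
  - by move=> cx -> ? ?; exists L1, f.
  - by move=> /node_sigma[f cx] /node_sigma[g ->] le_d; exists d, f.
  - by case/node_sigma=> g ->; exists f.
  - by move=> cx -> ? ?; exists f.
case cy: (c y) => [s g]; case: s g cy => [[]|[] L||d|] g cy /=.
- by case=> f [cx *]; exact: (sim_in leD cx cy).
- by case=> f [cx *]; exact: (sim_out leD cx cy).
- by case=> L1 [f [cx *]]; exact: (sim_branch leD cx cy).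
- by case=> L1 [f [cx *]]; exact: (sim_select leD cx cy).
- by case=> f cx; apply: sim_end; rewrite /sigma ?cx ?cy.
- by case=> d' [f [cx le_d]]; apply: (sim_bsc _ _ _ le_d); rewrite /sigma ?cx ?cy.
- by case=> f [cx *]; exact: (sim_par cx cy).
Qed.

(** The output clause swaps the arguments of [R] on data, but [R] still occurs only positively.
    Hence the union of all simulations is itself a simulation, which is [sim_unfold]. *)
Lemma sim_view_mono (R S : X -> X -> Prop) (x : X) (w : session_functor D Lab X) :
  (forall u v, R u v -> S u v) -> sim_view R x w -> sim_view S x w.
Proof.
move=> RS; case: w => -[[]|[] L||d|] g //=.
- by case=> f [? /RS ? /RS ?]; exists f.
- by case=> f [? /RS ? /RS ?]; exists f.
- by case=> L1 [f [? ? fg]]; exists L1, f; split=> // *; exact/RS/fg.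
- by case=> L1 [f [? ? fg]]; exists L1, f; split=> // *; exact/RS/fg.
- by case=> f [? /RS ? ?]; exists f.
Qed.

Lemma sim_unfold (x y : X) : sim leD c x y -> sim_view (sim leD c) x (c y).
Proof.
case=> R RP /RP/sim_stepP; apply: sim_view_mono => u v Ruv.
by exists R.
Qed.

Lemma sim_coind (R : X -> X -> Prop) (x y : X) :
  (forall u v, R u v -> sim_view R u (c v)) -> R x y -> sim leD c x y.
Proof. by move=> RP Rxy; exists R => // u v /RP/sim_stepP. Qed.

Lemma sim_refl (leD_refl : reflexive leD) (x : X) : sim leD c x x.
Proof.
apply: (@sim_coind eq) => // u _ <-.
case cu: (c u) => [s g]; case: s g cu => [[]|[] L||d|] g cu /=.
- by exists g.
- by exists g.
(* [h1] and [h2] prove the same boolean membership, so both sides apply [g] to the same index. *)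
- by exists L, g; split=> // l h1 h2; rewrite (bool_irrelevance h1 h2).
- by exists L, g; split=> // l h1 h2; rewrite (bool_irrelevance h1 h2).
- by exists g.
- by exists d, g.
- by exists g.
Qed.

(** The composite of [sim] with itself is a simulation. Where output reverses the data, the two
    reversed steps still compose through the data of the middle state. *)
Lemma sim_trans (leD_trans : transitive leD) (y x z : X) :
  sim leD c x y -> sim leD c y z -> sim leD c x z.
Proof.
move=> xy yz.
pose R u w := exists2 v, sim leD c u v & sim leD c v w.
apply: (@sim_coind R); last by exists y.
move=> {x y z xy yz} x z [y /sim_unfold xy /sim_unfold]; move: xy.
(* The shape of [z] determines that of [y]; rewriting with the node of [y] then lets the view in
   [xy] compute. *)
case: (c z) => -[[]|[] L||d|] g /= xy.
- case=> h [cy ? ?]; move: xy; rewrite cy => -[f [? ? ?]].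
  by exists f; split=> //; [exists (h c_star) | exists (h c_one)].
- case=> h [cy ? ?]; move: xy; rewrite cy => -[f [? ? ?]].
  by exists f; split=> //; [exists (h c_star) | exists (h c_one)].
- case=> L2 [h [cy le2 hg]]; move: xy; rewrite cy => -[L1 [f [? le1 fh]]].
  exists L1, f; split=> // [|l h1 h3]; first exact: fsubset_trans le2.
  have h2 : l \in val L2 by exact: (fsubsetP le1).
  by exists (h [` h2]).
- case=> L2 [h [cy le2 hg]]; move: xy; rewrite cy => -[L1 [f [? le1 fh]]].
  exists L1, f; split=> // [|l h1 h3]; first exact: fsubset_trans le1.
  have h2 : l \in val L2 by exact: (fsubsetP le2).
  by exists (h [` h2]).
- by case=> h cy; move: xy; rewrite cy.
- case=> d2 [h [cy le2]]; move: xy; rewrite cy => -[d1 [f [cx le1]]].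
  by exists d1, f; split=> //; exact: leD_trans le2.
- case=> h [cy ? hg]; move: xy; rewrite cy => -[f [? ? fh]].
  by exists f; split=> //; [exists (h tt) | rewrite fh].
Qed.

Lemma sim_un (x y : X) : sim leD c x y -> un c y -> un c x.
Proof.
move=> /sim_unfold xy [] => [/node_sigma | /node_sigma | [d /node_sigma]] [g cy];
  move: xy; rewrite cy.
- by case=> f [cx _ _]; constructor 1; rewrite /sigma cx.
- by case=> f cx; constructor 2; rewrite /sigma cx.
- by case=> d' [f [cx _]]; constructor 3; exists d'; rewrite /sigma cx.
Qed.

End Similarity.

(** * Similarity of contexts and its compatibility with the typing rules *)

Section Subsumption.

Variables (D : Type) (leD : rel D).
Hypotheses (leD_refl : reflexive leD) (leD_trans : transitive leD).
Variables (Lab V : choiceType) (X : Type) (c : X -> session_functor D Lab X).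

Definition ctx_sim (G H : {fmap V -> X}) : Prop :=
  forall z, match G.[? z], H.[? z] with
            | Some T, Some U => sim leD c T U
            | None, None => True
            | _, _ => False
            end.

Lemma ctx_sim_refl (G : {fmap V -> X}) : ctx_sim G G.
Proof. by move=> z; case: fndP => // zG; exact: sim_refl. Qed.

Lemma ctx_sim_dom (G H : {fmap V -> X}) (z : V) :
  ctx_sim G H -> (z \in domf G) = (z \in domf H).
Proof. by move=> /(_ z); case: fndP => ?; case: fndP. Qed.

Lemma ctx_sim_set (G H : {fmap V -> X}) (x : V) (T U : X) :
  ctx_sim G H -> sim leD c T U -> ctx_sim G.[x <- T] H.[x <- U].
Proof. by move=> GH TU z; rewrite !fnd_set; case: eqP => // _; exact: GH. Qed.

(** Typing rules and splits speak of contexts of the form [H.[x <- U]]; this decomposes a smaller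
    context in the same way, so that the same rule applies to it. The witness for [G'] is [G] with
    [x] removed. *)
Lemma ctx_sim_setP (G H : {fmap V -> X}) (x : V) (U : X) :
  x \notin domf H -> ctx_sim G H.[x <- U] ->
  exists G' T, [/\ G = G'.[x <- T], x \notin domf G', ctx_sim G' H &
                   sim leD c T U].
Proof.
move=> xH GH; have := GH x; rewrite fnd_set eqxx.
case Gx: G.[? x] => [T|] // TU; exists G.[~ x], T; split=> //.
- apply/fmapP => z; rewrite fnd_set fnd_rem1.
  by case: eqP => [->|].
- by rewrite domf_rem !inE eqxx.
- move=> z; have := GH z; rewrite fnd_set fnd_rem1.
  by case: eqP => [-> _|_]; first by rewrite (not_fnd xH).
Qed.

Lemma ctx_sim_un (G H : {fmap V -> X}) :
  ctx_sim G H -> un_ctx c H -> un_ctx c G.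
Proof.
move=> GH unH x T Gx; have := GH x; rewrite Gx.
by case Hx: H.[? x] => [U|] // TU; apply: (sim_un TU); exact: unH Hx.
Qed.

(** The split of [H] is replayed on [G], each binding going to the same side or sides. A duplicated
    binding stays unrestricted by [sim_un]. *)
Lemma ctx_sim_split (G H H1 H2 : {fmap V -> X}) :
  ctx_split c H H1 H2 -> ctx_sim G H ->
  exists G1 G2, [/\ ctx_split c G G1 G2, ctx_sim G1 H1 & ctx_sim G2 H2].
Proof.
move=> split_H; elim: split_H G => {H H1 H2}
  [|H H1 H2 x U _ IH xH unU|H H1 H2 x U _ IH xH|H H1 H2 x U _ IH xH] G GH.
- exists [fmap], [fmap]; split; try exact: ctx_sim_refl.
  suff -> : G = [fmap] by exact: split_nil.
  apply/fmapP => z; have := GH z; rewrite (@not_fnd _ _ [fmap] z) ?inE //.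
  by case: G.[? z].
- have [K [T [-> xK KH TU]]] := ctx_sim_setP xH GH.
  have [K1 [K2 [K12 le1 le2]]] := IH _ KH.
  exists K1.[x <- T], K2.[x <- T]; split; try exact: ctx_sim_set.
  by apply: split_both => //; exact: sim_un TU unU.
- have [K [T [-> xK KH TU]]] := ctx_sim_setP xH GH.
  have [K1 [K2 [K12 le1 le2]]] := IH _ KH.
  exists K1.[x <- T], K2; split=> //; last exact: ctx_sim_set.
  exact: split_left.
- have [K [T [-> xK KH TU]]] := ctx_sim_setP xH GH.
  have [K1 [K2 [K12 le1 le2]]] := IH _ KH.
  exists K1, K2.[x <- T]; split=> //; last exact: ctx_sim_set.
  exact: split_right.
Qed.

Lemma typed_ctx_sim (G H : {fmap V -> X}) (P : proc Lab V) :
  typed leD c H P -> ctx_sim G H -> typed leD c G P.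
Proof.
move=> typed_H; elim: typed_H G => {H P}.
- by move=> H unH G GH; apply: ty_inact; exact: ctx_sim_un unH.
- move=> H x y T U P xH yH _ IH TU G GH.
  (* The restricted variables keep their types [T] and [U], so the duality premise carries over
     unchanged. *)
  have GxHx := ctx_sim_set x GH (sim_refl c leD_refl T).
  apply: (ty_res _ _ _ TU).
  + by rewrite (ctx_sim_dom _ GH).
  + by rewrite (ctx_sim_dom _ GxHx).
  + by apply: IH; apply: ctx_sim_set => //; exact: sim_refl.
- move=> H H1 H2 P Q H12 _ IH1 _ IH2 G GH.
  have [G1 [G2 [G12 le1 le2]]] := ctx_sim_split H12 GH.
  by apply: (ty_par G12); [exact: IH1 | exact: IH2].
- by move=> H P _ IH unH G GH; apply: ty_rep; [exact: IH | exact: ctx_sim_un unH].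
- move=> H x y T U P f cT yH xHy _ IH fU G GH.
  have xH : x \notin domf H.
    by apply: contra xHy; rewrite dom_setf !inE => ->; rewrite orbT.
  have [K [S [-> xK KH ST]]] := ctx_sim_setP xH GH.
  move: (sim_unfold ST); rewrite cT => -[g [cS gf_star gf_one]].
  have KyHy := ctx_sim_set y KH (sim_refl c leD_refl U).
  apply: (ty_in cS (U := U)).
  + by rewrite (ctx_sim_dom _ KH).
  + by rewrite (ctx_sim_dom _ KyHy).
  + by apply: IH; exact: ctx_sim_set.
  (* Input data is covariant: [g c_one] is below [f c_one], which is below [U]. *)
  + exact: sim_trans fU.
- move=> H x y T U P f cT xH yHx _ IH Uf G GH.
  (* The outer binding [y] is peeled off first, then [x]; [yKx] is kept in the goal so that the
     second rewriting reaches it too. *)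
  have [Kx [S' [-> yKx KxHx S'U]]] := ctx_sim_setP yHx GH.
  move: yKx; have [K [S [-> xK KH ST]]] := ctx_sim_setP xH KxHx.
  move: (sim_unfold ST); rewrite cT => -[g [cS gf_star fg_one]] yKx.
  apply: (ty_out cS) => //; first by apply: IH; exact: ctx_sim_set.
  (* Output data is contravariant, giving the chain [S'], [U], [f c_one], [g c_one]. *)
  by apply: (sim_trans leD_trans S'U); exact: sim_trans fg_one.
- move=> H x T L1 L2 P f cT xH L12 _ IH G GH.
  have [K [S [-> xK KH ST]]] := ctx_sim_setP xH GH.
  move: (sim_unfold ST); rewrite cT => -[L0 [g [cS L01 gf]]].
  (* The smaller type offers fewer labels, [L0] within [L1] within [L2], so every branch to be typed
     was already typed. *)
  apply: (ty_branch cS) => // [|l h0 h2]; first exact: fsubset_trans L12.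
  have h1 : l \in val L1 by exact: (fsubsetP L01).
  by apply: (IH l h1); exact: ctx_sim_set.
- move=> H x T L l P f lL cT xH _ IH G GH.
  have [K [S [-> xK KH ST]]] := ctx_sim_setP xH GH.
  move: (sim_unfold ST); rewrite cT => -[L0 [g [cS L0L gf]]].
  (* For selection the smaller type has more labels, so [l] remains available. *)
  have lL0 : l \in val L0 by exact: (fsubsetP L0L).
  by apply: (ty_sel (h := lL0) cS) => //; apply: IH; exact: ctx_sim_set.
- move=> H x T P f cT parT xH _ IH G GH.
  have [K [S [-> xK KH ST]]] := ctx_sim_setP xH GH.
  move: (sim_unfold ST); rewrite cT => -[g [cS gf par_gf]].
  apply: (ty_unpack cS) => //; last by apply: IH; exact: ctx_sim_set.
  exact/(parst_par _ cS)/par_gf/(parst_par _ cT).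
Qed.

End Subsumption.

Theorem theorem2 (D : Type) (leD : rel D) (leD_refl : reflexive leD)
    (leD_trans : transitive leD) (Lab V : choiceType)
    (X : Type) (c : X -> session_functor D Lab X)
    (G : {fmap V -> X}) (x : V) (P : proc Lab V) (T U : X) :
  x \notin domf G ->
  typed leD c G.[x <- T] P ->
  sim leD c U T ->
  typed leD c G.[x <- U] P.
Proof.
move=> _ typed_P UT; apply: (typed_ctx_sim leD_refl leD_trans typed_P).
by apply: ctx_sim_set => //; exact: ctx_sim_refl.
Qed.
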